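(* Suppose that $k\ge 2$ and $\mathbf h\in\mathbb Z^k\setminus\{\mathbf 0\}$. Then, for each $\varepsilon>0$, one has $$U_{2t,k}(P;\mathbf h)\ll P^{t-1+\varepsilon}\quad (1\le t\le k)$$ for positive integers $P$, where the implied constant depends at most on $k$ and $\varepsilon$.
   Context: For natural numbers $s,k$, a positive integer $P$, and $\mathbf h=(h_1,\ldots,h_k)\in\mathbb Z^k$, $U_{s,k}(P;\mathbf h)$ denotes the number of integer tuples $(x_1,\ldots,x_s)$ with $|x_i|\le P$ $(1\le i\le s)$ satisfying $$\sum_{i=1}^s x_i^{2j-1}=h_j\quad (1\le j\le k).$$ Here $t$ is an integer. *)

(* Defs.v *)
From mathcomp Require Import all_boot all_order all_algebra finmap.
From mathcomp Require Import boolp classical_sets cardinality.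
From mathcomp Require Import reals exp.

Set Implicit Arguments.
Unset Strict Implicit.
Unset Printing Implicit Defensive.

Import Order.TTheory GRing.Theory Num.Theory.

Local Open Scope classical_set_scope.
Local Open Scope ring_scope.

(* Indices are 0-based, so j : 'I_k stands for j + 1 and the exponent
   2 (j + 1) - 1 is j.*2.+1. *)
Definition Usols (s k P : nat) (h : 'rV[int]_k) : set 'rV[int]_s :=
  [set x : 'rV[int]_s | (forall i : 'I_s, `|x 0 i| <= P%:Z) /\
     (forall j : 'I_k, \sum_(i < s) x 0 i ^+ j.*2.+1 = h 0 j)].
Arguments Usols s {k} P h.

(* [fset_set] sends infinite sets to fset0, so that [U] is a genuine count
   only because of this lemma. *)
Lemma Usols_finite (s k P : nat) (h : 'rV[int]_k) :
  finite_set (Usols s P h).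
Proof.
pose f (y : 'rV['I_(P.*2).+1]_s) : 'rV[int]_s :=
  \row_i ((y 0 i : nat)%:Z - P%:Z).
apply: (@sub_finite_set _ _ (f @` setT)); last exact/finite_image/finite_finset.
move=> x [xP _]; exists (\row_i inord (absz (x 0 i + P%:Z))) => //.
apply/rowP => i; rewrite !mxE.
move: (xP i); rewrite ler_norml => /andP[lo hi].
have x0 : 0 <= x 0 i + P%:Z by rewrite -lerBlDr sub0r.
rewrite inordK; first by rewrite gez0_abs // addrK.
by rewrite ltnS -lez_nat gez0_abs // -addnn PoszD lerD2r.
Qed.

Definition U (s k P : nat) (h : 'rV[int]_k) : nat :=
  #|` fset_set (Usols s P h)|%fset.
Arguments U s {k} P h.

(* Main.v *)
(** Let n = t + 1. If no two entries of x_1, ..., x_n sum to zero, then the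
    product of the x_i + x_j over ordered pairs i <> j is essentially
    determined by the odd power sums of exponents 1, 3, ..., 2n - 3. Indeed, if
    y has the same odd power sums, then the polynomial W with roots x_i and
    - y_i satisfies W(X) - W(-X) = c X by Newton's identities, and comparing
    the values at all the roots shows that either the two products agree or
    every x_i is some y_j.

    Given a solution of the system in 2t variables, either two entries cancel,
    and one inducts on t (with O(P) choices for the cancelling pair), or one
    fixes t - 1 of the entries. The remaining n entries then have prescribed odd
    power sums, so each x_i + x_j divides a fixed nonzero integer of size
    P^O(1), and the divisor bound leaves O(P^eps) choices. For t = 1 the sum of
    two entries does not determine them; this is where k >= 2 is used, through
    the sum of cubes. *)
Require Import Defs.
From mathcomp Require Import all_boot all_order all_algebra.
From mathcomp Require Import reals exp.
From mathcomp Require Import zify ring.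

Set Implicit Arguments.
Unset Strict Implicit.
Unset Printing Implicit Defensive.

Import Order.TTheory GRing.Theory Num.Theory.

Local Open Scope ring_scope.

(** * Newton's identities and the product of the pair sums *)

Section OddPowerSums.
Variable R : numDomainType.
Implicit Types (u : seq R) (a : R).

Lemma perm_cons_rem (T : eqType) (s : seq T) (x y : T) :
  y \in s -> perm_eq (rem y (x :: s)) (x :: rem y s).
Proof.
by move=> ys /=; case: eqVneq => [->|//]; apply: perm_to_rem.
Qed.

Lemma deriv_prod_XsubC u :
  (\prod_(a <- u) ('X - a%:P))^`() =
  \sum_(a <- u) \prod_(b <- rem a u) ('X - b%:P).
Proof.
elim: u => [|c u IH]; first by rewrite !big_nil derivC.
rewrite !big_cons derivM derivXsubC mul1r IH /= eqxx; congr (_ + _).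
rewrite mulr_sumr; apply: eq_big_seq => a au.
by rewrite (perm_big _ (perm_cons_rem c au)) big_cons.
Qed.

Lemma size_prod_XsubC_seq u : size (\prod_(a <- u) ('X - a%:P)) = (size u).+1.
Proof. exact: size_prod_XsubC. Qed.

Lemma prod_XsubC_rem u a : a \in u ->
  \prod_(b <- u) ('X - b%:P) =
  ('X - a%:P) * \prod_(b <- rem a u) ('X - b%:P).
Proof. by move=> au; rewrite (perm_big _ (perm_to_rem au)) big_cons. Qed.

(** Synthetic division: V = W / (X - a) satisfies V_j = W_(j+1) + a V_(j+1), and M steps lead past
    the degree of V. *)
Lemma coef_prod_rem u a (j M : nat) : a \in u -> (size u <= j + M)%N ->
  (\prod_(b <- rem a u) ('X - b%:P))`_j =
  \sum_(l < M) a ^+ l * (\prod_(b <- u) ('X - b%:P))`_(j + l).+1.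
Proof.
move=> au; elim: M j => [|M IH] j sM.
  rewrite big_ord0 nth_default // size_prod_XsubC_seq size_rem //.
  by case: (u) au sM => //= ? ? _; rewrite addn0.
rewrite big_ord_recl expr0 mul1r addn0.
under [X in _ = _ + X]eq_bigr => l _ do rewrite lift0 exprS -mulrA addnS -addSn.
have WE := prod_XsubC_rem au.
rewrite {1}WE mulrBl coefB coefXM coefCM /=.
by rewrite -mulr_sumr -IH ?addSnnS // subrK.
Qed.

(** Compare the coefficients of X^(i-1) in W' = sum of W / (X - a), each quotient being expanded by
    synthetic division. *)
Lemma newton_prod_XsubC u (i : nat) : (0 < i <= size u)%N ->
  (\prod_(b <- u) ('X - b%:P))`_i *+ (size u - i) =
  - \sum_(l < size u - i)
      (\sum_(a <- u) a ^+ l.+1) * (\prod_(b <- u) ('X - b%:P))`_(i + l.+1).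
Proof.
case: i => // j /= ju; set W := \prod_(b <- u) _.
have: W^`()`_j = \sum_(l < (size u - j)) (\sum_(a <- u) a ^+ l) * W`_(j + l).+1.
  rewrite deriv_prod_XsubC coef_sum.
  under [RHS]eq_bigr => l _ do rewrite mulr_suml.
  rewrite exchange_big /=; apply: eq_big_seq => a au.
  by apply: coef_prod_rem => //; lia.
rewrite coef_deriv.
have -> : (size u - j = (size u - j.+1).+1)%N by lia.
rewrite big_ord_recl addn0.
have -> : \sum_(a <- u) a ^+ 0 = (size u)%:R.
  by under eq_bigr => a _ do rewrite expr0; rewrite big_const_seq count_predT iter_addr_0.
under [X in _ = _ + X]eq_bigr => l _ do rewrite lift0 -addSn.
rewrite mulr_natl => e.
by rewrite mulrnBr // e opprD addrA subrr add0r.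
Qed.

(** Descending induction on i. In Newton's identity for odd i, an odd power sum has exponent at most
    [size u - 3], as i >= 3, and so vanishes; an even one multiplies a coefficient of odd index
    above i. By parity i differs from [size u], so the factor [size u - i] cancels. *)
Lemma odd_coef_prod_XsubC u (i : nat) : ~~ odd (size u) ->
  (forall l, odd l -> (l.+3 <= size u)%N -> \sum_(a <- u) a ^+ l = 0) ->
  odd i -> (3 <= i)%N -> (\prod_(b <- u) ('X - b%:P))`_i = 0.
Proof.
move=> eu p0; have [n] := ubnP (size u - i)%N.
elim: n i => // n IH i ni oi i3.
have [iu|ui] := leqP i (size u); last by rewrite nth_default // size_prod_XsubC_seq.
have iu' : (0 < size u - i)%N by lia.
have := @newton_prod_XsubC u i; rewrite iu andbT => /(_ (ltnW (ltnW i3))).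
rewrite [X in - X]big1 ?oppr0 => [/eqP|l _].
  by rewrite mulrn_eq0 // => /orP[|/eqP]; first by lia.
have [ol|el] := boolP (odd l.+1).
  by rewrite p0 ?mul0r //; have := ltn_ord l; lia.
rewrite IH ?mulr0 //; have := ltn_ord l; lia.
Qed.

Lemma prod_opp_seq (T : Type) (s : seq T) (f : T -> R) :
  \prod_(b <- s) - f b = (-1) ^+ size s * \prod_(b <- s) f b.
Proof.
by under eq_bigr => b _ do rewrite -mulN1r;
   rewrite big_split big_const_seq count_predT iter_mulr_1.
Qed.

(* The hypotheses say that W = \prod_b (X - b) satisfies
   W(X) - W(-X) = 2 W_1 X; both sides are compared at the root a. *)
Lemma prod_add_rem u a : ~~ odd (size u) ->
  (forall l, odd l -> (l.+3 <= size u)%N -> \sum_(a <- u) a ^+ l = 0) ->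
  a \in u ->
  \prod_(b <- rem a u) (a + b) = - (\prod_(b <- u) ('X - b%:P))`_1.
Proof.
move=> eu p0 au; set W := \prod_(b <- u) _.
have WE := prod_XsubC_rem au; rewrite -/W in WE.
set V := \prod_(b <- rem a u) _ in WE.
have u0 : (0 < size u)%N by case: (u) au.
have VN : V.[- a] = - \prod_(b <- rem a u) (a + b).
  rewrite horner_prod; under eq_bigr => b _ do rewrite hornerXsubC -opprD.
  rewrite prod_opp_seq size_rem // -signr_odd.
  have -> : odd (size u).-1 by case: (size u) u0 eu => //= n _; rewrite negbK.
  by rewrite mulN1r.
apply: oppr_inj; rewrite opprK -VN.
(* The comparison carries a factor a, so the root 0 is read off from W = X V instead. *)
have [a0|a0] := eqVneq a 0.
  by rewrite WE a0 oppr0 subr0 coefXM /= horner_coef0.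
have : W.[a] - W.[- a] = W`_1 * a *+ 2.
  rewrite !horner_coef -sumrB size_prod_XsubC_seq.
  case: (size u) u0 => // n _.
  rewrite (bigD1 (Ordinal (isT : 1 < n.+2)%N)) //= big1 => [|i].
    by rewrite expr1 addr0; ring.
  rewrite -val_eqE /= => i1; rewrite -mulrBr.
  have [oi|ei] := boolP (odd i); last first.
    by rewrite exprNn -signr_odd (negbTE ei) mul1r subrr mulr0.
  rewrite /W odd_coef_prod_XsubC ?mul0r //.
  by case: (nat_of_ord i) i1 oi => [|[|[]]].
rewrite WE !hornerM hornerXsubC subrr mul0r sub0r hornerXsubC.
rewrite -WE -mulNr => e.
apply: (mulIf a0); apply: (@mulIf _ 2); first by rewrite pnatr_eq0.
by rewrite [RHS]mulr_natr -e; ring.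
Qed.

Lemma perm_rem_cons (T : eqType) (s t : seq T) (a : T) :
  perm_eq s (a :: t) -> perm_eq (rem a s) t.
Proof.
move=> st; rewrite -(perm_cons a) -(permPr st) perm_sym perm_to_rem //.
by rewrite (perm_mem st) mem_head.
Qed.

(** [rem] drops one occurrence, so this runs over ordered pairs of distinct positions; a single
    entry 0 does not make it vanish. *)
Definition pairprod u : R := \prod_(a <- u) \prod_(b <- rem a u) (a + b).

(** By [prod_add_rem], all roots of the list x, -y give the same product c. If c = 0, each entry of
    x lies in y or makes [pairprod x] vanish. If not, multiplying over the roots from x, and over
    those from y, gives [pairprod x * Z = c ^+ size x = pairprod y * Z]. *)
Lemma pairprod_eq (x y : seq R) : size x = size y ->
  (forall l, odd l -> (l < (size x).*2.-1)%N ->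
     \sum_(a <- x) a ^+ l = \sum_(a <- y) a ^+ l) ->
  {subset x <= y} \/ pairprod x = pairprod y \/ pairprod x = 0.
Proof.
move=> sxy pxy; pose y' := [seq - b | b <- y].
have su : (size (x ++ y') = (size x).*2)%N by rewrite size_cat size_map -sxy addnn.
have : exists c, forall a, a \in x ++ y' -> \prod_(b <- rem a (x ++ y')) (a + b) = c.
  eexists => a; apply: prod_add_rem; rewrite su ?odd_double // => l ol lx.
  rewrite big_cat big_map /= pxy //; last by lia.
  rewrite -big_split big1 //= => b _.
  by rewrite exprNn -signr_odd ol mulN1r subrr.
case=> c uc.
have xc a : a \in x ->
    \prod_(b <- rem a x) (a + b) * \prod_(b <- y) (a - b) = c.
  move=> ax; rewrite -(uc a) ?mem_cat ?ax // (perm_big _ (perm_rem_cons (s := x ++ y') (t := rem a x ++ y') _)).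
    by rewrite big_cat big_map.
  by rewrite -cat_cons perm_cat2r perm_to_rem.
have yc a : a \in y ->
    (-1) ^+ (size x).-1 * \prod_(b <- rem a y) (a + b) * \prod_(b <- x) (b - a) = c.
  move=> ay; have ay' : - a \in y' by rewrite map_f.
  rewrite -(uc (- a)) ?mem_cat ?ay' ?orbT //.
  rewrite (perm_big _ (perm_rem_cons (s := x ++ y') (t := map -%R (rem a y) ++ x) _)).
    rewrite big_cat big_map sxy -(size_rem ay) -prod_opp_seq /=.
    by congr (_ * _); apply: eq_bigr => b _; rewrite ?opprD // addrC.
  by rewrite perm_catC -cat_cons perm_cat2r -(map_cons _ a) perm_map // perm_to_rem.
have [c0|c0] := eqVneq c 0.
  have [x0|x0] := eqVneq (pairprod x) 0; first by right; right.
  left=> a ax; have /eqP := xc a ax; rewrite c0 mulf_eq0 => /orP[|].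
    by move=> ea; case/negP: x0; rewrite prodf_seq_eq0; apply/hasP; exists a.
  by rewrite prodf_seq_eq0 => /hasP[b bY /=]; rewrite subr_eq0 => /eqP ->.
right; left; pose Z := \prod_(a <- x) \prod_(b <- y) (a - b).
have ex : pairprod x * Z = c ^+ size x.
  rewrite -big_split /= (eq_big_seq (fun=> c)) ?big_const_seq ?count_predT ?iter_mulr_1 //.
have ey : pairprod y * Z = c ^+ size x.
  rewrite /Z exchange_big -big_split /= sxy.
  transitivity (\prod_(a <- y) c); last by rewrite big_const_seq count_predT iter_mulr_1.
  (* The n signs (-1)^(n-1) multiply to 1, as n(n-1) is even. *)
  transitivity (\prod_(a <- y) (-1) ^+ (size x).-1 * (\prod_(a <- y) (\prod_(b <- rem a y) (a + b) * \prod_(b <- x) (b - a)))).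
    rewrite big_const_seq count_predT iter_mulr_1 -sxy -exprM.
    by rewrite -signr_odd oddM; case: (size x) => [|n] /=; rewrite ?andbF ?andbN ?mul1r.
  rewrite -big_split /=; apply: eq_big_seq => a ay.
  by rewrite mulrA yc.
have Z0 : Z != 0.
  by apply: contraNneq c0 => Z0; move/eqP: ex; rewrite Z0 mulr0 eq_sym expf_eq0 => /andP[].
by apply: (mulIf Z0); rewrite ex ey.
Qed.
End OddPowerSums.

(** * The divisor bound *)

Lemma size_divisors n :
  size (divisors n) = (\prod_(f <- prime_decomp n) f.2.+1)%N.
Proof.
rewrite /divisors; elim: (prime_decomp n) => [|[p e] pd IH].
  by rewrite big_nil.
rewrite big_cons /= -IH; elim: e => [|e IHe] /=; first by rewrite mul1n.
by rewrite size_merge size_cat size_map IHe [RHS]mulSn addnC.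
Qed.

(** For p >= 2^m, (e+1)^m <= 2^(me) <= p^e. For smaller p, e + 1 <= m 2^(e %/ m), whose m-th power
    is at most m^m p^e. *)
Lemma succ_expn_le (m p e : nat) : (0 < m)%N -> (1 < p)%N ->
  (e.+1 ^ m <= (if p < 2 ^ m then m ^ m else 1) * p ^ e)%N.
Proof.
move=> m0 p1; case: ltnP => [_|pm]; last first.
  rewrite mul1n (leq_trans (n := ((2 ^ m) ^ e)%N)) //; last by case: (e) => // d; rewrite leq_exp2r.
  by rewrite -expnM mulnC expnM leq_exp2r // ltn_expl.
have e1 : (e.+1 <= m * (e %/ m).+1)%N by rewrite mulnC ltn_ceil.
apply: (@leq_trans ((m * 2 ^ (e %/ m)) ^ m)%N).
  by rewrite leq_exp2r // (leq_trans e1) // leq_mul2l ltn_expl ?orbT.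
rewrite expnMn leq_mul2l -expnM; apply/orP; right.
apply: (@leq_trans (2 ^ e)%N); first by rewrite leq_exp2l ?leq_divM.
by case: (e) => // d; rewrite leq_exp2r.
Qed.

(** This is d(n) << n^(1/m) in integer form. Only primes below 2^m contribute a factor m^m, and
    there are at most 2^m of them. *)
Lemma divisor_bound (m : nat) : (0 < m)%N ->
  exists2 C : nat, (0 < C)%N &
    forall n : nat, (0 < n)%N -> (size (divisors n) ^ m <= C * n)%N.
Proof.
move=> m0; exists ((m ^ m) ^ (2 ^ m))%N; first by rewrite !expn_gt0 m0.
move=> n n0; rewrite size_divisors.
have -> : ((\prod_(f <- prime_decomp n) f.2.+1) ^ m =
           \prod_(f <- prime_decomp n) f.2.+1 ^ m)%N.
  by elim/big_rec2: _ => [|f a b _ <-]; rewrite ?exp1n ?expnMn.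
apply: (@leq_trans (\prod_(f <- prime_decomp n)
    ((if f.1 < 2 ^ m then m ^ m else 1) * f.1 ^ f.2))%N).
  rewrite big_seq [leqRHS]big_seq; apply: leq_prod => -[p e] /=.
  by move=> /mem_prime_decomp[/prime_gt1 p1 _ _]; apply: succ_expn_le.
rewrite big_split /= -(prod_prime_decomp n0) leq_mul2r; apply/orP; right.
rewrite -(big_map fst xpredT (fun p => if (p < 2 ^ m)%N then (m ^ m)%N else 1%N)).
rewrite -big_mkcond /= -big_filter big_const_seq count_predT iter_muln_1.
rewrite leq_pexp2l ?expn_gt0 ?m0 //.
rewrite -[leqRHS](size_iota 0 (2 ^ m)%N) uniq_leq_size //.
  by rewrite filter_uniq // -/(unzip1 _) -/(primes n) primes_uniq.
by move=> p; rewrite mem_filter mem_iota => /andP[].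
Qed.

(** * Recovering the entries from the divisors of the pair product *)

Definition zdivisors (z : int) : seq int :=
  map Posz (divisors `|z|) ++ map (fun d : nat => - d%:Z) (divisors `|z|).

Lemma mem_zdivisors (d z : int) : z != 0 -> (d %| z)%Z -> d \in zdivisors z.
Proof.
move=> z0 dz; have dd : `|d|%N \in divisors `|z|.
  by rewrite -dvdn_divisors ?absz_gt0.
rewrite mem_cat; case: (intP d) dd => [|n|n] dd; apply/orP.
- by left; apply: map_f.
- by left; apply: map_f.
- by right; apply/mapP; exists n.+1; rewrite // abszN in dd *.
Qed.

Lemma dvdz_pairprod (x : seq int) (a b : int) :
  a \in x -> b \in rem a x -> (a + b %| pairprod x)%Z.
Proof.
move=> ax bx; rewrite /pairprod (big_rem a) //= (big_rem b) //=.
by rewrite -mulrA dvdz_mulr.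
Qed.

Definition half_sums (D : seq int) : seq int :=
  [seq ((p.1 + p.2 - d) %/ 2)%Z | p <- [seq (a, b) | a <- D, b <- D], d <- D].

Lemma size_half_sums D : size (half_sums D) = (size D ^ 3)%N.
Proof. by rewrite !size_allpairs !expnS muln1 mulnA. Qed.

(* a = ((a + b) + (a + c) - (b + c)) / 2 for any two further entries b, c. *)
Lemma mem_half_sums (x : seq int) (a : int) :
  (2 < size x)%N -> pairprod x != 0 -> a \in x ->
  a \in half_sums (zdivisors (pairprod x)).
Proof.
move=> x3 x0 ax; have xa := perm_to_rem ax.
have: (1 < size (rem a x))%N by rewrite size_rem // ; case: size x3.
case E : (rem a x) xa => [|b [|c r]] // xa _.
have bax : b \in rem a x by rewrite E mem_head.
have cax : c \in rem a x by rewrite E !inE eqxx orbT.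
have cbx : c \in rem b x.
  rewrite (perm_mem (perm_rem_cons (t := [:: a, c & r]) _)) ?inE ?eqxx ?orbT //.
  by rewrite (perm_trans xa) // (perm_catCA [:: a] [:: b]).
have bx := mem_rem bax.
apply/allpairsP; exists ((a + b, a + c), b + c); split => /=.
- by apply: allpairs_f; apply: mem_zdivisors => //; apply: dvdz_pairprod.
- by apply: mem_zdivisors => //; apply: dvdz_pairprod.
- have -> : a + b + (a + c) - (b + c) = a * 2 by ring.
  by rewrite mulzK.
Qed.

(** Substituting b = c + d - a turns the difference of the two sums of cubes into 3(a + b)(a - c)(a
    - d). *)
Lemma mem_pair_of_sums (R : idomainType) (a b c d : R) : 3%:R != 0 :> R ->
  a + b != 0 -> a + b = c + d -> a ^+ 3 + b ^+ 3 = c ^+ 3 + d ^+ 3 ->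
  a \in [:: c; d].
Proof.
move=> n3 ab0 e1 e3; rewrite !inE -subr_eq0 -[a == d]subr_eq0 -mulf_eq0.
have : 3%:R * (a + b) * ((a - c) * (a - d)) == 0.
  apply/eqP; have -> : b = c + d - a by rewrite -e1; ring.
  have -> : 3%:R * (a + (c + d - a)) * ((a - c) * (a - d)) =
    (a ^+ 3 + (c + d - a) ^+ 3) - (c ^+ 3 + d ^+ 3) by ring.
  have <- : b = c + d - a by rewrite -e1; ring.
  by rewrite e3 subrr.
by rewrite !mulf_eq0 (negbTE n3) (negbTE ab0).
Qed.

(** The candidates depend on y only. For t >= 2 there are at least three entries and [mem_half_sums]
    applies; for t = 1 there are two, and [maxn t 2] makes the cubes available. *)
Lemma mem_fiber (t : nat) (x y : seq int) : (0 < t)%N ->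
  size x = t.+1 -> size y = t.+1 ->
  (forall j, (j < maxn t 2)%N ->
     \sum_(a <- x) a ^+ j.*2.+1 = \sum_(a <- y) a ^+ j.*2.+1) ->
  pairprod x != 0 ->
  {subset x <= y ++ half_sums (zdivisors (pairprod y))}.
Proof.
move=> t0 sx sy pxy x0 a ax; rewrite mem_cat.
have [t1|t1] := leqP t 1.
  apply/orP; left; move: sx sy pxy ax x0; have -> : t = 1%N by lia.
  case: x => [|a1 [|b [|]]] //; case: y => [|c [|d [|]]] // _ _ pxy.
  have := pxy 0%N isT; have := pxy 1%N isT; rewrite !big_cons !big_nil !addr0 !expr1.
  move=> e3 e1; rewrite /pairprod big_cons /= eqxx big_seq1 mulf_eq0 negb_or.
  case: (eqVneq a a1) => [-> _ /andP[ab _]|aa1].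
    exact: mem_pair_of_sums ab e1 e3.
  rewrite 2!in_cons (negbTE aa1) in_nil orbF /= => /eqP -> /andP[ab _].
  by apply: (@mem_pair_of_sums _ b a1 c d isT); rewrite addrC.
have pl l : odd l -> (l < (size x).*2.-1)%N ->
    \sum_(a <- x) a ^+ l = \sum_(a <- y) a ^+ l.
  by rewrite sx => ol lt; rewrite -(odd_double_half l) ol add1n pxy //; lia.
apply/orP; have [xy|[yx|/eqP]] := pairprod_eq (etrans sx (esym sy)) pl.
- by left; apply: xy.
- by right; rewrite -yx; apply: mem_half_sums; rewrite // sx.
- by rewrite (negbTE x0).
Qed.

(** * Covering lists, and solutions as sequences *)

Fixpoint words (T : Type) (S : seq T) (n : nat) : seq (seq T) :=
  if n is m.+1 then [seq a :: w | a <- S, w <- words S m] else [:: [::]].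

Lemma size_words (T : Type) (S : seq T) n : size (words S n) = (size S ^ n)%N.
Proof. by elim: n => //= n IH; rewrite size_allpairs IH expnS. Qed.

Lemma mem_words (T : eqType) (S w : seq T) :
  {subset w <= S} -> w \in words S (size w).
Proof.
elim: w => [|a w IH] //= wS; apply: allpairs_f; first by rewrite wS ?mem_head.
by apply: IH => b bw; rewrite wS // in_cons bw orbT.
Qed.

(** Union bound over fibres. Solutions are counted by lists that contain them, possibly with
    repetitions. *)
Lemma cover_flatten (I T : eqType) (Y : seq I) (Q : I -> T -> Prop) (B : nat) :
  (forall i, exists2 L : seq T, (size L <= B)%N & forall x, Q i x -> x \in L) ->
  exists2 L : seq T, (size L <= size Y * B)%N &
    forall i x, i \in Y -> Q i x -> x \in L.
Proof.
move=> cover; elim: Y => [|i Y [L sL LP]]; first by exists [::].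
have [M sM MP] := cover i; exists (M ++ L).
  by rewrite size_cat mulSn leq_add.
move=> j x; rewrite inE mem_cat => /predU1P[->|jY] Qx; first by rewrite MP.
by rewrite (LP j) ?orbT.
Qed.

Definition zbox (P : nat) : seq int :=
  [seq i%:Z - P%:Z | i <- iota 0 (P.*2).+1].

Lemma mem_zbox (P : nat) (a : int) : (`|a| <= P%:Z) -> a \in zbox P.
Proof.
move=> aP; apply/mapP; exists (absz (a + P%:Z)); last by lia.
by rewrite mem_iota; lia.
Qed.

Lemma size_zbox (P : nat) : (0 < P)%N -> (size (zbox P) <= 3 * P)%N.
Proof. by rewrite size_map size_iota; lia. Qed.

(** Sequences let entries be permuted, removed and split off without reindexing. *)
Definition odd_sol (k P : nat) (h : 'rV[int]_k) (n : nat) (s : seq int) : Prop :=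
  [/\ size s = n, forall a, a \in s -> `|a| <= P%:Z &
      forall j : 'I_k, \sum_(a <- s) a ^+ j.*2.+1 = h 0 j].

Lemma absz_prod_le (I : eqType) (s : seq I) (f : I -> int) (B : nat) :
  (forall i, i \in s -> (`|f i| <= B)%N) ->
  (`|(\prod_(i <- s) f i)%R| <= B ^ size s)%N.
Proof.
elim: s => [|i s IH] fB; first by rewrite big_nil.
rewrite big_cons abszM expnS leq_mul ?fB ?mem_head // IH // => j js.
by rewrite fB // in_cons js orbT.
Qed.

Lemma absz_pairprod_le (x : seq int) (P : nat) :
  (forall a, a \in x -> `|a| <= P%:Z) ->
  (`|pairprod x| <= P.*2 ^ ((size x).-1 * size x))%N.
Proof.
move=> xP; rewrite expnM; apply: absz_prod_le => a ax.
rewrite -(size_rem ax); apply: absz_prod_le => b /mem_rem bx.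
by have := xP _ ax; have := xP _ bx; lia.
Qed.

Lemma pairprod_eq0 (R : numDomainType) (x : seq R) : pairprod x = 0 ->
  exists a s, perm_eq x [:: a, - a & s].
Proof.
move/eqP; rewrite prodf_seq_eq0 => /hasP[a ax /=].
rewrite prodf_seq_eq0 => /hasP[b bx /=]; rewrite addrC addr_eq0 => /eqP ba.
exists a, (rem b (rem a x)); rewrite -ba.
by rewrite (perm_trans (perm_to_rem ax)) // perm_cons perm_to_rem.
Qed.

Lemma odd_sol_cancel (k P n : nat) (h : 'rV[int]_k) (a : int) (s s' : seq int) :
  perm_eq s [:: a, - a & s'] -> odd_sol P h n.+2 s -> odd_sol P h n s'.
Proof.
move=> ss' [sn sP sh]; split.
- by move/perm_size: ss'; rewrite sn => -[].
- by move=> b bs'; rewrite sP // (perm_mem ss') !inE bs' !orbT.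
- move=> j; rewrite -sh (perm_big _ ss') !big_cons exprNn -signr_odd /= odd_double.
  by rewrite mulN1r addNKr.
Qed.

(** * The induction on t *)

Section Cover.
Variables (k P T : nat) (h : 'rV[int]_k).
Hypotheses (k2 : (2 <= k)%N) (P0 : (0 < P)%N).
Hypothesis divT : forall n : nat, (0 < n <= P.*2 ^ (k * k.+1))%N ->
  (size (divisors n) <= T)%N.

Lemma cover_opposite (t : nat) (L : seq (seq int)) :
  (forall s, odd_sol P h t.*2 s -> s \in L) ->
  exists2 M : seq (seq int), (size M <= size L * (3 * P) * t.*2.+2 ^ t.*2.+2)%N &
    forall s a s', odd_sol P h t.+1.*2 s -> perm_eq s [:: a, - a & s'] -> s \in M.
Proof.
move=> Lsol; pose Q (i : seq int * int) (s : seq int) :=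
  odd_sol P h t.+1.*2 s /\ perm_eq s [:: i.2, - i.2 & i.1].
have [|M sM MP] := @cover_flatten _ _ [seq (s, a) | s <- L, a <- zbox P] Q
    (t.*2.+2 ^ t.*2.+2).
  move=> [s' a]; have [s't|s't] := eqVneq (size s') t.*2; last first.
    by exists [::] => // s [[ss _ _] /perm_size /= e]; by case/eqP: s't; move: e; rewrite ss doubleS => -[].
  (* Crude count of the rearrangements: words of length 2t + 2 in these 2t + 2 entries. *)
  exists (words [:: a, - a & s'] t.*2.+2); first by rewrite size_words /= s't.
  move=> s [[ss _ _] sp]; rewrite -doubleS -ss; apply: mem_words => b.
  by rewrite (perm_mem sp).
exists M.
  by rewrite (leq_trans sM) // leq_mul2r size_allpairs leq_mul ?orbT ?size_zbox.
move=> s a s' ss sp; apply: (MP (s', a)) => //.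
apply: allpairs_f; first exact: Lsol (odd_sol_cancel sp ss).
by case: ss => _ sP _; rewrite mem_zbox // sP // (perm_mem sp) mem_head.
Qed.

(** The last t entries are chosen in O(P^t) ways. Fix one solution s0 with that tail; the first t +
    2 entries of the others have the same odd power sums as those of s0, so [mem_fiber] confines
    them. *)
Lemma cover_generic (t : nat) : (t < k)%N ->
  exists2 M : seq (seq int),
    (size M <= (3 * P) ^ t * ((k + 9) ^ k.+1 * T ^ (3 * k.+1)))%N &
    forall s, odd_sol P h t.+1.*2 s -> pairprod (take t.+2 s) != 0 -> s \in M.
Proof.
move=> tk; pose Q (y s : seq int) :=
  [/\ odd_sol P h t.+1.*2 s, pairprod (take t.+2 s) != 0 & drop t.+2 s = y].
have T1 : (0 < T)%N.
  by have := @divT 1%N; apply; rewrite expn_gt0 double_gt0 P0.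
have [|M sM MP] := @cover_flatten _ _ (words (zbox P) t) Q
    ((k + 9) ^ k.+1 * T ^ (3 * k.+1)).
  move=> y; have [[s0 [[ss0 sP0 sh0] N0 dy]]|no] := boolp.pselect (exists s, Q y s); last first.
    by exists [::] => // s Qs; case: no; exists s.
  set x0 := take t.+2 s0 in N0.
  have sx0 : size x0 = t.+2 by rewrite size_takel // ss0 doubleS -addnn !ltnS leq_addr.
  exists (map (cat^~ y) (words (x0 ++ half_sums (zdivisors (pairprod x0))) t.+2)).
    have dT : (size (divisors `|pairprod x0|) <= T)%N.
      apply: divT; rewrite absz_gt0 N0 /=.
      apply: (leq_trans (@absz_pairprod_le _ P _)) => [a /mem_take|]; first exact: sP0.
      by rewrite sx0 leq_pexp2l ?double_gt0 // leq_mul.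
    rewrite size_map size_words size_cat size_half_sums size_cat !size_map sx0 addnn.
    (* The alphabet has t + 2 + (2T)^3 <= (k + 9) T^3 letters. *)
    apply: (@leq_trans (((k + 9) * T ^ 3) ^ t.+2)%N).
      have -> : (k + 9 = k.+1 + 8)%N by lia.
      rewrite leq_exp2r // mulnDl leq_add //; last first.
        by rewrite -muln2 expnMn mulnC leq_mul // leq_exp2r.
      by apply: (@leq_trans k.+1) => //; rewrite leq_pmulr // expn_gt0 T1.
    rewrite expnM -expnMn leq_pexp2l ?muln_gt0 ?expn_gt0 ?T1 //; lia.
  move=> s [[ss sP sh] N dsy]; rewrite -[s](cat_take_drop t.+2) dsy.
  apply: map_f; have sx : size (take t.+2 s) = t.+2.
    by rewrite size_takel // ss doubleS -addnn !ltnS leq_addr.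
  rewrite -[X in words _ X]sx; apply: mem_words; apply: (@mem_fiber t.+1) => // j jt.
  have jk : (j < k)%N by lia.
  apply: (addIr (\sum_(a <- y) a ^+ j.*2.+1)).
  rewrite -{1}dsy -{1}dy -!big_cat !cat_take_drop.
  by rewrite (sh (Ordinal jk)) (sh0 (Ordinal jk)).
exists M.
  apply: (leq_trans sM); rewrite size_words leq_mul //.
  by case: (t) => // d; rewrite leq_exp2r ?size_zbox.
move=> s ss N; apply: (MP (drop t.+2 s)) => //.
case: (ss) => sn sP _; have e : size (drop t.+2 s) = t.
  by rewrite size_drop sn doubleS -addnn; lia.
by rewrite -[X in words _ X]e; apply: mem_words => a /mem_drop/sP/mem_zbox.
Qed.

Lemma odd_sol_cover_step (t C : nat) (L : seq (seq int)) : (t < k)%N ->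
  (forall s, odd_sol P h t.*2 s -> s \in L) ->
  (size L * P <= C * P ^ t * T ^ (3 * k.+1))%N ->
  exists2 M : seq (seq int),
    (size M * P <= (3 * t.*2.+2 ^ t.*2.+2 * C + 3 ^ t * (k + 9) ^ k.+1) *
       P ^ t.+1 * T ^ (3 * k.+1))%N &
    forall s, odd_sol P h t.+1.*2 s -> s \in M.
Proof.
move=> tk LP sL; have [M1 sM1 M1P] := cover_opposite LP.
have [M2 sM2 M2P] := cover_generic tk.
exists (M1 ++ M2).
  move: sM1 sM2 sL; rewrite (expnS P t) expnMn size_cat.
  set A := (_ ^ t.*2.+2)%N; set B := (T ^ _)%N => sM1 sM2 sL.
  rewrite (mulnDl (_ * C)%N (3 ^ t * _)%N) mulnDl [leqRHS]mulnDl.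
  apply: leq_add.
    apply: (leq_trans (leq_mul sM1 (leqnn P))).
    apply: leq_trans (eq_leq _) (leq_trans (leq_mul sL (leqnn (3 * P * A)%N)) (eq_leq _)); ring.
  by apply: (leq_trans (leq_mul sM2 (leqnn P))); apply: eq_leq; ring.
move=> s ss; rewrite mem_cat; have [N0|N] := eqVneq (pairprod (take t.+2 s)) 0.
  have [a [s' xs']] := pairprod_eq0 N0.
  rewrite (M1P s a (s' ++ drop t.+2 s)) //.
  by rewrite -[s in perm_eq s](cat_take_drop t.+2) -!cat_cons perm_cat2r.
by rewrite M2P ?orbT.
Qed.
End Cover.

(** The factor P on the left encodes the exponent t - 1 without subtraction, even at t = 0, where
    [h != 0] leaves no solution and C = 0 starts the induction. *)
Lemma odd_sol_cover (k t : nat) : (2 <= k)%N -> (t <= k)%N ->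
  exists C : nat, forall (P T : nat) (h : 'rV[int]_k), (0 < P)%N -> h != 0 ->
    (forall n : nat, (0 < n <= P.*2 ^ (k * k.+1))%N ->
       (size (divisors n) <= T)%N) ->
    exists2 L : seq (seq int), (size L * P <= C * P ^ t * T ^ (3 * k.+1))%N &
      forall s, odd_sol P h t.*2 s -> s \in L.
Proof.
move=> k2; elim: t => [_|t IH tk].
  exists 0%N => P T h _ h0 _; exists [::] => // s [/size0nil -> _ sh].
  case/eqP: h0; apply/rowP => j; rewrite -sh big_nil mxE //.
have [C CP] := IH (ltnW tk).
exists (3 * t.*2.+2 ^ t.*2.+2 * C + 3 ^ t * (k + 9) ^ k.+1)%N => P T h P0 h0 divT.
have [L sL LP] := CP P T h P0 h0 divT.
exact: (odd_sol_cover_step k2 P0 divT tk LP sL).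
Qed.

(** * From covering lists to the bound for [U] *)

Lemma U_le_cover (k P n : nat) (h : 'rV[int]_k) (L : seq (seq int)) :
  (forall s, odd_sol P h n s -> s \in L) -> (U n P h <= size L)%N.
Proof.
move=> LP; pose f (x : 'rV[int]_n) := [seq x 0 i | i <- enum 'I_n].
have f_inj : injective f.
  move=> x y /eq_in_map xy; apply/rowP => i; apply: xy; exact: mem_enum.
rewrite /U -(size_map f); apply: uniq_leq_size => [|s].
  by rewrite map_inj_uniq // finmap.fset_uniq.
move=> /mapP[x xU ->]; apply: LP.
move: xU; rewrite cardinality.in_fset_set; last exact: Usols_finite.
rewrite classical_sets.in_setE => -[xP xh]; split; first by rewrite size_map size_enum_ord.
  by move=> a /mapP[i _ ->]; apply: xP.
by move=> j; rewrite big_map big_enum xh.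
Qed.

Lemma divisor_bound_max (m : nat) : (0 < m)%N ->
  exists2 C : nat, (0 < C)%N &
    forall N : nat, (0 < N)%N -> exists2 T : nat, (T ^ m <= C * N)%N &
      forall n : nat, (0 < n <= N)%N -> (size (divisors n) <= T)%N.
Proof.
move=> m0; have [C C0 CP] := divisor_bound m0; exists C => // N N0.
exists (\max_(n < N.+1 | (0 < n)%N) size (divisors n)).
  elim/big_ind: _ => [|x y xC yC|n n0]; first by rewrite exp0n.
    by rewrite /maxn; case: ifP.
  by rewrite (leq_trans (CP _ n0)) // leq_mul2l leq_ord orbT.
move=> n /andP[n0 nN].
exact: (@leq_bigmax_cond _ _ (fun n : 'I_N.+1 => size (divisors n)) (Ordinal (nN : n < N.+1)%N)).
Qed.

Lemma odd_sol_cover_uniform (k : nat) : (2 <= k)%N ->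
  exists C : nat, forall (t P T : nat) (h : 'rV[int]_k),
    (t <= k)%N -> (0 < P)%N -> h != 0 ->
    (forall n : nat, (0 < n <= P.*2 ^ (k * k.+1))%N ->
       (size (divisors n) <= T)%N) ->
    exists2 L : seq (seq int), (size L * P <= C * P ^ t * T ^ (3 * k.+1))%N &
      forall s, odd_sol P h t.*2 s -> s \in L.
Proof.
move=> k2.
have [C CP] := boolp.choice (fun t : 'I_k.+1 => odd_sol_cover k2 (ltn_ord t)).
exists (\sum_(t < k.+1) C t)%N => t P T h tk P0 h0 divT.
have [L sL LP] := CP (Ordinal (tk : t < k.+1)%N) P T h P0 h0 divT; exists L => //.
rewrite (leq_trans sL) // leq_mul2r leq_mul2r.
by rewrite (bigD1 (Ordinal (tk : t < k.+1)%N)) //= leq_addr !orbT.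
Qed.

(** Take q-th roots: D^(1/q) <= D and P^(K/q) <= P^eps, since D and P are at least 1. *)
Lemma le_powR_of_exp_le (R : realType) (eps : R) (X D P K q : nat) :
  (0 < q)%N -> K%:R <= eps * q%:R -> (0 < D)%N -> (0 < P)%N ->
  (X ^ q <= D * P ^ K)%N -> X%:R <= D%:R * P%:R `^ eps.
Proof.
move=> q0 Kq D0 P0 Xq.
rewrite -(ler_pXn2r q0) ?nnegrE ?mulr_ge0 ?powR_ge0 //.
rewrite exprMn -[X in _ <= _ * X]powR_mulrn ?powR_ge0 // -powRrM.
rewrite -natrX (le_trans (y := (D * P ^ K)%:R)) ?ler_nat // natrM.
rewrite ler_pM //; first by rewrite -natrX ler_nat -[leqLHS]expn1 leq_pexp2l.
by rewrite natrX -powR_mulrn // ler_powR // ler1n.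
Qed.

Theorem corollary1p7 (R : realType) (k : nat) (hk : (2 <= k)%N)
    (eps : R) (heps : 0 < eps) :
  exists2 C : R, 0 < C &
    forall (h : 'rV[int]_k) (t P : nat),
      h != 0 -> (1 <= t <= k)%N -> (0 < P)%N ->
      (U (2 * t) P h)%:R <= C * P%:R `^ (t%:R - 1 + eps).
Proof.
have [C CP] := odd_sol_cover_uniform hk.
set K := (k * k.+1)%N in CP; set e := (3 * k.+1)%N in CP.
pose q := (Num.bound (K%:R / eps)).+1.
have Kq : K%:R <= eps * q%:R.
  rewrite mulrC -ler_pdivrMr //; apply: (@le_trans _ _ (q.-1)%:R).
    by apply/ltW/archi_boundP; rewrite divr_ge0 // ltW.
  by rewrite ler_nat.
(* With the exponent e q the bound reads (T^e)^q <= D (2P)^K, and q was chosen with K / q <= eps, so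
   T^e << P^eps. *)
have [D D0 DP] := @divisor_bound_max (e * q) isT.
pose D' := (D * 2 ^ K)%N; have D'0 : (0 < D')%N by rewrite muln_gt0 D0 expn_gt0.
(* [C.+1] keeps the constant positive. *)
exists (C.+1 * D')%:R; first by rewrite ltr0n muln_gt0.
move=> h [//|t] P h0 /andP[_ tk] P0.
have [|T TP divT] := DP (P.*2 ^ K)%N; first by rewrite expn_gt0 double_gt0 P0.
have [L sL LP] := CP t.+1 P T h tk P0 h0 divT.
have Teps : (T ^ e)%:R <= D'%:R * P%:R `^ eps :> R.
  apply: (le_powR_of_exp_le (q := q) _ Kq) => //.
  by rewrite -expnM (leq_trans TP) // -mul2n expnMn mulnA.
have sL' : (size L <= C.+1 * P ^ t * T ^ e)%N.
  rewrite -(leq_pmul2r P0) (leq_trans sL) // expnS.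
  by rewrite mulnCA -!mulnA [leqLHS]mulnC -!mulnA leq_mul.
have UL : (U (2 * t.+1) P h <= size L)%N by apply: U_le_cover; rewrite mul2n.
rewrite (le_trans (y := (C.+1 * P ^ t * T ^ e)%:R)) ?ler_nat ?(leq_trans UL) //.
have P0' : P%:R != 0 :> R by rewrite pnatr_eq0 -lt0n.
rewrite -natr1 addrK powRD ?P0' ?implybT // powR_mulrn //.
rewrite 2!natrM (natrM _ C.+1 D') natrX -!mulrA ler_pM2l // [leRHS]mulrCA.
by apply: ler_wpM2l; rewrite // exprn_ge0.
Qed.
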